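(* For every integer $p\ge 1$, the set $\langle a,P(a,p)+1\rangle$ consists of a single integer, and this integer is $\max\langle b,p\rangle$; that is, $\langle a,P(a,p)+1\rangle=\{\max\langle b,p\rangle\}$.
   Context: The Fibonacci sequence $\mathbb{F}$ is the infinite word over $\{a,b\}$ that begins with $a$ and is fixed by the morphism $\sigma$ with $\sigma(a)=ab$, $\sigma(b)=a$; letters are indexed from $1$. Put $F_{-1}=b$ and $F_m=\sigma^m(a)$ for $m\ge 0$. Let $\delta_m$ be the last letter of $F_m$. The $m$-th singular word ($m\ge -1$) is $K_m=\delta_{m+1}F_m\delta_m^{-1}$, i.e. $F_m$ with its last letter deleted and $\delta_{m+1}$ prepended; thus $K_{-1}=a$, $K_0=b$, $K_1=aa$, $K_2=bab$. For a nonempty factor $\omega$ of $\mathbb{F}$, $Ker(\omega)$ is the maximal singular word occurring in $\omega$, i.e. $K_m$ with the largest index $m$ such that $K_m$ is a factor of $\omega$. For a factor $\omega$ and $p\ge1$, $P(\omega,p)$ is the position in $\mathbb{F}$ of the last letter of the $p$-th occurrence of $\omega$ (overlapping occurrences allowed, ordered from left to right); in particular $P(a,p)$ is the position of the $p$-th letter $a$. Let $\mathcal{P}$ be the set of palindromes (nonempty words equal to their reversal) occurring in $\mathbb{F}$, and set $\langle K_m,p\rangle=\{P(\omega,p):\omega\in\mathcal{P},\ Ker(\omega)=K_m\}$; in particular $\langle a,p\rangle=\langle K_{-1},p\rangle$ and $\langle b,p\rangle=\langle K_0,p\rangle$. *)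

(* Defs.v *)
From HB Require Import structures.
From mathcomp Require Import all_boot all_order all_algebra.
From mathcomp Require Import boolp classical_sets.

Set Implicit Arguments.
Unset Strict Implicit.
Unset Printing Implicit Defensive.

Import Order.TTheory GRing.Theory Num.Theory.

Local Open Scope classical_set_scope.

Inductive letter := La | Lb.

Definition letter_to_bool (x : letter) : bool := if x is La then true else false.
Definition bool_to_letter (x : bool) : letter := if x then La else Lb.
Lemma letter_to_boolK : cancel letter_to_bool bool_to_letter.
Proof. by case. Qed.
HB.instance Definition _ := Countable.copy letter (can_type letter_to_boolK).

Notation word := (seq letter).

Definition sigma (w : word) : word :=
  flatten [seq (if x is La then [:: La; Lb] else [:: La]) | x <- w].

(* The letter of index i >= 1 of an infinite word u : nat -> letter is u i.-1,
   so that mkseq u n consists of the letters of index 1, ..., n.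
   As sigma u is the infinite word with all the sigma (mkseq u n) as prefixes,
   the second conjunct says that sigma u = u. *)
Definition is_fibonacci (u : nat -> letter) : Prop :=
  u 0 = La /\
  forall n, sigma (mkseq u n) = mkseq u (size (sigma (mkseq u n))).

(* Indices range over int because they start at -1; values at m < -1 are
   meaningless and never used. *)
Definition Fw (m : int) : word :=
  if m is Posz n then iter n sigma [:: La] else [:: Lb].

Definition delta (m : int) : letter := last La (Fw m).

Definition K (m : int) : word :=
  delta (m + 1)%R :: take (size (Fw m)).-1 (Fw m).

Definition is_max {d} {T : porderType d} (A : set T) (x : T) : Prop :=
  A x /\ ubound A x.

(* Ker(w) = k *)
Definition Ker_is (w k : word) : Prop :=
  exists2 m : int, is_max [set j : int | (-1 <= j)%R /\ infix (K j) w] m & k = K m.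

(* An occurrence of w in u has its last letter at position n. *)
Definition occ_end (u : nat -> letter) (w : word) (n : nat) : bool :=
  suffix w (mkseq u n).

(* P(w, p), for w nonempty and p >= 1; its value is 0, which is not a position,
   if w has fewer than p occurrences in u. *)
Definition P (u : nat -> letter) (w : word) (p : nat) : nat :=
  xget 0 [set n | occ_end u w n /\ count (occ_end u w) (iota 1 n) = p].

Definition pal (u : nat -> letter) : set word :=
  [set w | [/\ w <> [::], rev w = w & exists n, occ_end u w n]].

(* The set <k, p>. *)
Definition bracket (u : nat -> letter) (k : word) (p : nat) : set nat :=
  [set P u w p | w in [set w | pal u w /\ Ker_is w k]].

Lemma K_N1 : K (-1)%R = [:: La]. Proof. by []. Qed.
Lemma K_0 : K 0%R = [:: Lb]. Proof. by []. Qed.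
Lemma K_1 : K 1%R = [:: La; La]. Proof. by []. Qed.
Lemma K_2 : K 2%R = [:: Lb; La; Lb]. Proof. by []. Qed.

Lemma sigma_cat v w : sigma (v ++ w) = sigma v ++ sigma w.
Proof. by rewrite /sigma map_cat flatten_cat. Qed.

Lemma size_sigma w : size w <= size (sigma w).
Proof. by elim: w => //= -[] w IH; rewrite /= ltnS // ltnW. Qed.

Lemma fibonacci_unique u v : is_fibonacci u -> is_fibonacci v -> u = v.
Proof.
move=> [u0 uS] [v0 vS].
suff H n : mkseq u n.+1 = mkseq v n.+1.
  apply/funext => n; have /(congr1 (nth La ^~ n)) := H n.
  by rewrite !nth_mkseq.
elim: n => [|n IH]; first by rewrite /mkseq /= u0 v0.
have lt : n.+1 < size (sigma (mkseq u n.+1)).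
  rewrite /mkseq /= u0 /= !ltnS.
  by apply: leq_trans (size_sigma _); rewrite size_map size_iota.
have E : mkseq u (size (sigma (mkseq u n.+1))) =
         mkseq v (size (sigma (mkseq u n.+1))).
  by rewrite -uS IH -vS.
have /(congr1 (take n.+2)) := E.
by rewrite /mkseq -!map_take !take_iota (minn_idPl lt).
Qed.

Lemma fibonacci_exists : exists u, is_fibonacci u.
Proof.
pose f n := iter n sigma [:: La].
have fS n : exists2 t, f n.+1 = f n ++ t & t <> [::].
  elim: n => [|n [t E tn]]; first by exists [:: Lb].
  exists (sigma t); first by rewrite -[LHS]/(sigma (f n.+1)) {1}E sigma_cat.
  by case: t tn {E} => // -[].
have sf n : n < size (f n).
  elim: n => // n IH; have [t -> tn] := fS n.
  rewrite size_cat; case: t tn => //= x t _.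
  by rewrite addnS ltnS (leq_trans IH) ?leq_addr.
have pf m k : exists t, f (k + m) = f m ++ t.
  elim: k => [|k [t E]]; first by exists [::]; rewrite cats0.
  have [t' E' _] := fS (k + m); exists (t ++ t').
  by rewrite addSn E' E catA.
pose u n := nth La (f n) n.
have uf n k : k <= size (f n) -> mkseq u k = take k (f n).
  move=> kn; apply: (@eq_from_nth _ La); rewrite size_mkseq ?size_takel // => i ik.
  rewrite nth_mkseq // nth_take // /u.
  have [le|/ltnW le] := leqP i n.
    have [t] := pf i (n - i); rewrite subnK // => ->.
    by rewrite nth_cat sf.
  have [t] := pf n (i - n); rewrite subnK // => ->.
  by rewrite nth_cat (leq_trans ik kn).
exists u; split => // n.
have E : f n.+1 = sigma (mkseq u n) ++ sigma (drop n (f n)).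
  by rewrite (uf n) 1?ltnW // -sigma_cat cat_take_drop.
have le : size (sigma (mkseq u n)) <= size (f n.+1) by rewrite E size_cat leq_addr.
by rewrite (uf n.+1 _ le) E take_size_cat.
Qed.

(* Main.v *)
Require Import Defs.
From mathcomp Require Import all_boot all_order all_algebra.
From mathcomp Require Import boolp classical_sets.

(** The kernel condition leaves very few palindromes: only [a] has kernel [a],
    and only [b] and [aba] have kernel [b] ([bracket_a], [bracket_b]), because a
    word without the factors [aa], [bab] and [bb] has at most three letters.
    Every [b] of the Fibonacci word sits between two letters [a], so the
    [p]-th [aba] ends one letter after the [p]-th [b], and the statement becomes
    [P(a, P(a,p) + 1) = P(b,p) + 1].

    For this, let [w] be the prefix that ends with the [p]-th [a].  Its image
    [sigma w] is again a prefix, it ends with [b], it has as many letters [b] as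
    [w] has letters [a], namely [p], and as many letters [a] as [w] has letters,
    namely [P(a,p)].  Hence [sigma w] ends with the [p]-th [b], and the letter
    that follows it, the first letter of the next block [sigma x], is the
    [a] number [P(a,p) + 1]. *)

Set Implicit Arguments.
Unset Strict Implicit.
Unset Printing Implicit Defensive.

(** * Occurrences and their positions *)

(** The [p]-th occurrence is unique, so any end position with [p] occurrences
    up to it is the value of [P]. *)
Lemma P_count (u : nat -> letter) (w : word) (n p : nat) :
  occ_end u w n -> count (occ_end u w) (iota 1 n) = p -> P u w p = n.
Proof.
move=> on cn.
have lt_count i j : i < j -> occ_end u w j ->
    count (occ_end u w) (iota 1 i) < count (occ_end u w) (iota 1 j).
  case: j => // j; rewrite ltnS => lij oj.
  rewrite -[in X in _ < X](addn1 j) iotaD count_cat /= add1n oj addn1 ltnS.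
  by rewrite -(subnKC lij) iotaD count_cat leq_addr.
rewrite /P; apply: xget_unique => // m [om cm].
case: (ltngtP m n) => // lt.
  by have := lt_count _ _ lt on; rewrite cm cn ltnn.
by have := lt_count _ _ lt om; rewrite cm cn ltnn.
Qed.

Lemma occ_end_rcons (u : nat -> letter) (w : word) (x : letter) (n : nat) :
  occ_end u (rcons w x) n.+1 = (u n == x) && occ_end u w n.
Proof. by rewrite /occ_end mkseqS suffix_rcons eq_sym. Qed.

Lemma occ_end_letter (u : nat -> letter) (x : letter) (n : nat) :
  occ_end u [:: x] n.+1 = (u n == x).
Proof. by rewrite (occ_end_rcons u [::]) /occ_end suffix0s andbT. Qed.

Lemma count_occ_end_letter (u : nat -> letter) (x : letter) (n : nat) :
  count (occ_end u [:: x]) (iota 1 n) = count_mem x (mkseq u n).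
Proof.
rewrite (iotaDl 1 0) count_map /mkseq count_map.
by apply: eq_count => i /=; rewrite add1n occ_end_letter.
Qed.

Lemma size_mkseq_cat (u : nat -> letter) (n : nat) (t w : word) :
  mkseq u n = t ++ w -> forall i, i < size w -> nth La w i = u (size t + i).
Proof.
move=> E i li; have := congr1 (nth La ^~ (size t + i)) E.
rewrite nth_cat ltnNge leq_addr addKn /= => <-.
by rewrite nth_mkseq // -(size_mkseq u n) E size_cat ltn_add2l.
Qed.

(** * Letters of the Fibonacci word *)

Lemma sigma_rcons (w : word) (x : letter) :
  sigma (rcons w x) = sigma w ++ (if x is La then [:: La; Lb] else [:: La]).
Proof. by rewrite -cats1 sigma_cat /sigma /= cats0. Qed.

Lemma count_b_sigma (w : word) : count_mem Lb (sigma w) = count_mem La w.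
Proof.
by elim/last_ind: w => // w x IH; rewrite sigma_rcons -cats1 !count_cat IH; case: x.
Qed.

Lemma count_a_sigma (w : word) : count_mem La (sigma w) = size w.
Proof.
by elim/last_ind: w => // w x IH; rewrite sigma_rcons size_rcons count_cat IH;
  case: x; rewrite /= addn1.
Qed.

Section Fibonacci.

Variables (u : nat -> letter) (hu : is_fibonacci u).

(** As [u] is the concatenation of the blocks [sigma (u n)], the block number
    [n] starts at the index [block_start n]. *)
Definition block_start (n : nat) : nat := size (sigma (mkseq u n)).

Lemma block_startS (n : nat) :
  block_start n.+1 = block_start n + (if u n is La then 2 else 1).
Proof. by rewrite /block_start mkseqS sigma_rcons size_cat; case: (u n). Qed.

Lemma sigma_mkseq (n : nat) : sigma (mkseq u n) = mkseq u (block_start n).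
Proof. by case: hu. Qed.

Lemma block_startP (n : nat) :
  u (block_start n) = La /\ (u n = La -> u (block_start n).+1 = Lb).
Proof.
have := sigma_mkseq n.+1; rewrite block_startS mkseqS sigma_rcons sigma_mkseq.
case: (u n); rewrite ?addn2 ?addn1 !mkseqS -?cats1 -?catA;
  move/eqP; rewrite eqseq_cat // => /andP[_ /eqP[]].
  by move=> <- <-.
by move=> <-.
Qed.

Lemma block_cover (i : nat) :
  exists n, i = block_start n \/ (i = (block_start n).+1 /\ u n = La).
Proof.
elim: i => [|i [n [->|[-> un]]]]; first by exists 0; left.
  case E: (u n); first by exists n; right.
  by exists n.+1; left; rewrite block_startS E addn1.
by exists n.+1; left; rewrite block_startS un addn2.
Qed.

(** A letter [b] is the second letter of a block [ab]; the letters around it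
    are the first letter of that block and that of the next one. *)
Lemma b_between_a (i : nat) :
  u i = Lb -> exists2 j, i = j.+1 & u j = La /\ u i.+1 = La.
Proof.
move=> ui; have [n [Ei|[Ei un]]] := block_cover i.
  by move: ui; rewrite Ei (block_startP n).1.
exists (block_start n) => //; split; first exact: (block_startP n).1.
by have := (block_startP n.+1).1; rewrite block_startS un addn2 Ei.
Qed.

Lemma exists_nth_a (p : nat) :
  exists2 n, u n = La & count_mem La (mkseq u n.+1) = p.+1.
Proof.
have u0 : u 0 = La by case: hu.
elim: p => [|p [n un cn]]; first by exists 0; rewrite // /mkseq /= u0.
have cS k : count_mem La (mkseq u k.+1)
    = count_mem La (mkseq u k) + (u k == La).
  by rewrite mkseqS -cats1 count_cat /= addn0.
case E: (u n.+1).
  by exists n.+1; rewrite // cS cn E addn1.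
have [_ _ [_ Ea]] := b_between_a E.
by exists n.+2; rewrite // cS cS cn E Ea addn1 addn0.
Qed.

Lemma occ_end_aba (n : nat) :
  occ_end u [:: La; Lb; La] n.+1 = occ_end u [:: Lb] n.
Proof.
rewrite (occ_end_rcons u [:: La; Lb]); case: n => [|k]; first by case: (u 0).
rewrite (occ_end_rcons u [:: La]) occ_end_letter.
case: (u k =P Lb) => [uk|_] /=; last exact: andbF.
by have [j -> [uj /eqP ->]] := b_between_a uk; rewrite occ_end_letter uj.
Qed.

Lemma count_occ_end_aba (n : nat) :
  count (occ_end u [:: La; Lb; La]) (iota 1 n.+1)
    = count (occ_end u [:: Lb]) (iota 1 n).
Proof.
rewrite /= occ_end_aba add0n (iotaDl 1 1) count_map.
by apply: eq_count => i /=; rewrite add1n occ_end_aba.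
Qed.

(** * Palindromes with kernel a or b *)

Lemma size_Fw (n : nat) : n < size (Fw (Posz n)).
Proof.
suff : (n < size (Fw (Posz n))) && (La \in Fw (Posz n)) by case/andP.
elim: n => // n /andP[IH mem]; have -> : Fw (Posz n.+1) = sigma (Fw (Posz n)) by [].
(* An [a] in the word makes its image strictly longer. *)
have H w : La \in w -> (size w < size (sigma w)) && (La \in sigma w).
  case/splitPr => w1 w2; rewrite -cat1s !sigma_cat !mem_cat mem_head orbT andbT.
  by rewrite !size_cat -addnS leq_add //; exact: size_sigma.
by case/andP: (H _ mem) => lt ->; rewrite (leq_ltn_trans IH lt).
Qed.

(** Reduces every question about the singular words that occur in [w] to those
    of index less than [size w]. *)
Lemma size_K (n : nat) : n < size (K (Posz n)).
Proof.
rewrite /K /= size_take; have := size_Fw n.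
by case: (size _) => // k; rewrite /= ltnSn.
Qed.

Lemma K_eq_a (m : int) : (-1 <= m)%R -> K m = [:: La] -> m = (-1)%R.
Proof.
case: m => [[|n]|[]] // _ E.
by have := size_K n.+1; rewrite E.
Qed.

Lemma K_eq_b (m : int) : (-1 <= m)%R -> K m = [:: Lb] -> m = 0%R.
Proof.
case: m => [[|n]|[]] // _ E.
by have := size_K n.+1; rewrite E.
Qed.

Lemma Ker_a : Ker_is [:: La] [:: La].
Proof.
exists (-1)%R => //; split=> // j [j1]; case: j j1 => [n|[]] // _ inf.
by case: n inf => [|n] // /size_infix; rewrite leqNgt (leq_trans _ (size_K _)).
Qed.

Lemma Ker_b : Ker_is [:: Lb] [:: Lb].
Proof.
exists 0%R => //; split=> // j [j1]; case: j j1 => [n|[]] // _ inf.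
by case: n inf => [|n] // /size_infix; rewrite leqNgt (leq_trans _ (size_K _)).
Qed.

Lemma Ker_aba : Ker_is [:: La; Lb; La] [:: Lb].
Proof.
exists 0%R => //; split=> // j [j1]; case: j j1 => [n|[]] // _ inf.
case: n inf => [|[|[|n]]] // /size_infix.
by rewrite leqNgt (leq_trans _ (size_K _)).
Qed.

Lemma Ker_is_a (w : word) : w <> [::] -> Ker_is w [:: La] -> w = [:: La].
Proof.
move=> w0 [m [[m1 _] mx] /esym /(K_eq_a m1) mE]; subst m.
have nob : Lb \notin w.
  apply/negP => hb; suff : (0 <= -1 :> int)%R by [].
  by apply: mx; split=> //; case/splitPr: hb => p1 p2; apply/infixP; exists p1, p2.
have noaa : ~~ infix [:: La; La] w by apply/negP => H; have : (1 <= -1 :> int)%R by exact: mx.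
by case: w w0 nob noaa {mx} => [|[] [|[] w]] //=; rewrite ?inE ?prefix0s.
Qed.

Lemma no_bb (w : word) (n : nat) : occ_end u w n -> ~~ infix [:: Lb; Lb] w.
Proof.
case/suffixP => t E; apply/negP => /infixP[p [q Ew]].
rewrite Ew catA in E; have H := size_mkseq_cat E.
have [_ _ [_]] := b_between_a (esym (H 0 isT)).
by rewrite -addnS -(H 1 isT).
Qed.

(** Without [aa] and [bb] the word alternates, so with four letters it would
    contain [bab]; the shorter alternating words are checked one by one. *)
Lemma Ker_is_b (w : word) :
  pal u w -> Ker_is w [:: Lb] -> w = [:: Lb] \/ w = [:: La; Lb; La].
Proof.
case=> w0 rw [n /no_bb nobb] [m [[m1 mw] mx] /esym /(K_eq_b m1) mE]; subst m.
have noaa : ~~ infix [:: La; La] w by apply/negP => H; have : (1 <= 0 :> int)%R by exact: mx.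
have nobab : ~~ infix [:: Lb; La; Lb] w by apply/negP => H; have : (2 <= 0 :> int)%R by exact: mx.
case: w w0 rw nobb mw noaa nobab {mx} => [|x [|y [|z [|t w]]]] //.
- by case: x => // *; left.
- by case: x; case: y.
- by case: x; case: y; case: z => // *; right.
- by move=> _ _; case: x; case: y; case: z; case: t => //=;
    rewrite ?prefix0s ?orbT.
Qed.

Lemma pal_a : pal u [:: La].
Proof.
by split=> //; exists 1; rewrite occ_end_letter; case: hu => ->.
Qed.

Lemma bracket_a (p : nat) : bracket u [:: La] p = [set P u [:: La] p]%classic.
Proof.
rewrite eqEsubset; split=> [_ [w [[w0 _ _] /(Ker_is_a w0) ->] <-] //|_ ->].
by exists [:: La] => //; split; [exact: pal_a|exact: Ker_a].
Qed.

Lemma bracket_b (p : nat) :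
  bracket u [:: Lb] p
    = [set P u [:: Lb] p; P u [:: La; Lb; La] p]%classic.
Proof.
have ob : occ_end u [:: Lb] 2.
  rewrite occ_end_letter; have [u0 _] := hu.
  by have [_ /(_ u0) ->] := block_startP 0.
rewrite eqEsubset; split=> [_ [w [pw /(Ker_is_b pw) [->|->]] <-]|_ [->|->]].
- by left.
- by right.
- exists [:: Lb] => //; split; last exact: Ker_b.
  by split=> //; exists 2.
- exists [:: La; Lb; La] => //; split; last exact: Ker_aba.
  by split=> //; exists 3; rewrite occ_end_aba.
Qed.

(** * The p-th letters a and b *)

(** With [w] the prefix that ends with the [p]-th [a], both sides are read off
    [sigma w], whose length is the common value of [m] below. *)
Lemma P_a_P_b (p : nat) : 0 < p ->
  exists m, [/\ P u [:: Lb] p = m, P u [:: La; Lb; La] p = m.+1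
              & P u [:: La] (P u [:: La] p + 1) = m.+1].
Proof.
case: p => // p _; have [n un cn] := exists_nth_a p.
have Pa : P u [:: La] p.+1 = n.+1.
  by apply: P_count; rewrite ?occ_end_letter ?un // count_occ_end_letter.
pose m := block_start n.+1.
have ob : occ_end u [:: Lb] m.
  rewrite /m block_startS un addn2 occ_end_letter.
  by have [_ /(_ un) ->] := block_startP n.
have cb : count (occ_end u [:: Lb]) (iota 1 m) = p.+1.
  by rewrite count_occ_end_letter -sigma_mkseq count_b_sigma.
exists m; split.
- exact: P_count.
- by apply: P_count; rewrite ?occ_end_aba ?count_occ_end_aba.
- rewrite Pa; have um := (block_startP n.+1).1.
  apply: P_count; first by rewrite occ_end_letter um.
  rewrite count_occ_end_letter mkseqS -cats1 count_cat -sigma_mkseq.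
  by rewrite count_a_sigma size_mkseq /= um.
Qed.

End Fibonacci.

Theorem mainTheorem6 (u : nat -> letter) (hu : is_fibonacci u)
    (p : nat) (hp : (1 <= p)%N) :
  exists2 x : nat, is_max (bracket u [:: Lb] p) x &
    bracket u [:: La] (P u [:: La] p + 1)%N = [set x]%classic.
Proof.
have [m [Pb Paba Pa]] := P_a_P_b hu hp.
exists m.+1; last by rewrite (bracket_a hu) Pa.
rewrite (bracket_b hu) Pb Paba; split; first by right.
by move=> _ [->|->] //; exact: leqnSn.
Qed.
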